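(* Let $f_0:\mathbb{R}^n\times\mathbb{R}^d\to\mathbb{R}$, $f=(f_1,\dots,f_m):\mathbb{R}^n\times\mathbb{R}^d\to\mathbb{R}^m$ and $h:\mathbb{R}^n\times\mathbb{R}^d\to\mathbb{R}^p$ be such that, for every fixed $\theta\in\mathbb{R}^d$, the functions $x\mapsto f_i(x,\theta)$ ($i=0,1,\dots,m$) are convex and $x\mapsto h(x,\theta)$ is affine. Consider the parametrized convex problem of minimizing $f_0(x,\theta)$ over $x\in\mathbb{R}^n$ subject to $f(x,\theta)\preceq 0$ and $h(x,\theta)=0$. Let $g$ be the associated KKT function, with partial Jacobians $\mathsf{D}_z g$ and $\mathsf{D}_\theta g$, and let $\mathcal{S}:\mathbb{R}^d\rightrightarrows\mathbb{R}^{n}\times\mathbb{R}^m\times\mathbb{R}^p$ be the (primal-dual) solution mapping, all as defined in the context. Let $\bar\theta\in\mathbb{R}^d$ and $\tilde z=(\tilde x,\tilde\lambda,\tilde\nu)\in\mathbb{R}^n\times\mathbb{R}^m\times\mathbb{R}^p$ satisfy $g(\tilde z,\bar\theta)=0$, $f(\tilde x,\bar\theta)\preceq 0$ and $\tilde\lambda\succeq 0$. Assume: 1. (Strong duality) Slater's condition holds for the problem at $\bar\theta$: there is $x\in\mathbb{R}^n$ with $f_i(x,\bar\theta)<0$ for $i=1,\dots,m$ and $h(x,\bar\theta)=0$. 2. (Differentiability) The functions $f_i$ ($i=0,1,\dots,m$) are twice continuously differentiable in $x$, the function $f$ is continuously differentiable in $\theta$, the function $h$ is continuously differentiable in $\theta$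 and $x$, and $\mathsf{D}_x f$ is continuously differentiable in $\theta$. 3. (Emptiness of $G$) The set $G=\{i\in\{1,\dots,m\} : \tilde\lambda_i=0 \text{ and } f_i(\tilde x,\bar\theta)=0\}$ is empty. 4. The matrix $\mathsf{D}_z g(\tilde z,\bar\theta)$ is non-singular. Then the solution mapping $\mathcal{S}$ has a single-valued localization $s$ around $\bar\theta$ for $\tilde z$ that is continuously differentiable in a neighborhood $Q$ of $\bar\theta$, with Jacobian satisfying $$\mathsf{D}_\theta s(\theta) = -\,\mathsf{D}_z g(s(\theta),\theta)^{-1}\,\mathsf{D}_\theta g(s(\theta),\theta)\quad\text{for every }\theta\in Q.$$
   Context: Notation: $\nabla_x$ denotes the gradient (a column vector) and $\mathsf{D}_x$ the Jacobian matrix with respect to $x$ (for a map into $\mathbb{R}^k$, a $k\times n$ matrix); similarly for other variables. $\preceq$ and $\succeq$ are componentwise inequalities, and $\mathrm{diag}(v)$ is the diagonal matrix with diagonal $v$. Lagrangian: $L(x,\lambda,\nu,\theta)=f_0(x,\theta)+\lambda^T f(x,\theta)+\nu^T h(x,\theta)$ for $x\in\mathbb{R}^n$, $\lambda\in\mathbb{R}^m$, $\nu\in\mathbb{R}^p$, $\theta\in\mathbb{R}^d$. KKT function: writing $z=(x,\lambda,\nu)$, $$g(z,\theta)=\begin{bmatrix}\nabla_x L(x,\lambda,\nu,\theta)\\ \mathrm{diag}(\lambda) f(x,\theta)\\ h(x,\theta)\end{bmatrix}\in\mathbb{R}^{n+m+p}.$$ Its partial Jacobians are $$\mathsf{D}_z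 g(z,\theta)=\begin{bmatrix}\mathsf{D}_x\nabla_x L(x,\lambda,\nu,\theta) & \mathsf{D}_x f(x,\theta)^T & \mathsf{D}_x h(x,\theta)^T\\ \mathrm{diag}(\lambda)\mathsf{D}_x f(x,\theta) & \mathrm{diag}(f(x,\theta)) & 0\\ \mathsf{D}_x h(x,\theta) & 0 & 0\end{bmatrix},\qquad \mathsf{D}_\theta g(z,\theta)=\begin{bmatrix}\mathsf{D}_\theta\nabla_x L(x,\lambda,\nu,\theta)\\ \mathrm{diag}(\lambda)\mathsf{D}_\theta f(x,\theta)\\ \mathsf{D}_\theta h(x,\theta)\end{bmatrix}.$$ Solution mapping: $\mathcal{S}(\theta)$ is the set of all $(x,\lambda,\nu)$ satisfying the KKT conditions of the problem at $\theta$, namely $f(x,\theta)\preceq 0$, $h(x,\theta)=0$, $\lambda_i\ge 0$ and $\lambda_i f_i(x,\theta)=0$ for $i=1,\dots,m$, and $\nabla_x L(x,\lambda,\nu,\theta)=0$. Equivalently, $\mathcal{S}(\theta)$ is the set of $z=(x,\lambda,\nu)$ with $g(z,\theta)=0$, $f(x,\theta)\preceq0$ and $\lambda\succeq0$. Single-valued localization: a set-valued mapping $\mathcal{S}$ has a single-valued localization $s$ around $\bar\theta$ for $\tilde z\in\mathcal{S}(\bar\theta)$ if there are neighborhoods $U$ of $\bar\theta$ and $V$ of $\tilde z$ such that for every $\theta\in U$ the set $\mathcal{S}(\theta)\cap V$ consists of exactly one point, denoted $s(\theta)$ (so $s(\bar\theta)=\tilde z$).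
   Formalization: The gradient of f_0 in x is also assumed continuously differentiable in θ (else f_0=x²/2−|θ|^{1/2}x is a counterexample), and ''continuously differentiable'' in a variable means the partial derivatives are jointly continuous in (x,θ). *)

(* Defs.v *)
From HB Require Import structures.
From mathcomp Require Import all_boot all_order all_algebra.
From mathcomp Require Import all_classical all_reals all_analysis.

Set Implicit Arguments.
Unset Strict Implicit.
Unset Printing Implicit Defensive.

Import Order.TTheory GRing.Theory Num.Theory.
Import numFieldNormedType.Exports.

Local Open Scope classical_set_scope.
Local Open Scope ring_scope.

Section Derivatives.
Variable R : realType.

(* The library's jacobian acts on row vectors and is the transpose of the
   usual k x n matrix; the Jacobian of a map between spaces of column vectors
   is therefore written out here: its j-th column is the image of the j-th
   basis vector under the Frechet differential. *)
Definition Jac (n k : nat) (F : 'cV[R]_n -> 'cV[R]_k) (x : 'cV[R]_n) :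
    'M[R]_(k, n) :=
  \matrix_(i < k, j < n) ('d F x (delta_mx j 0) : 'cV[R]_k) i 0.

Definition grad (n : nat) (F : 'cV[R]_n -> R) (x : 'cV[R]_n) : 'cV[R]_n :=
  \col_(j < n) ('d F x (delta_mx j 0) : R).

(* Continuous differentiability in one group of variables: the partial
   derivative exists everywhere and is continuous in both arguments jointly. *)
Definition C1_fst (a b k : nat) (F : 'cV[R]_a -> 'cV[R]_b -> 'cV[R]_k) : Prop :=
  (forall u v, differentiable (F ^~ v) u) /\
  continuous (fun w : 'cV[R]_a * 'cV[R]_b => Jac (F ^~ w.2) w.1).

Definition C1_snd (a b k : nat) (F : 'cV[R]_a -> 'cV[R]_b -> 'cV[R]_k) : Prop :=
  (forall u v, differentiable (F u) v) /\
  continuous (fun w : 'cV[R]_a * 'cV[R]_b => Jac (F w.1) w.2).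

Definition grad_fst (a b : nat) (F : 'cV[R]_a -> 'cV[R]_b -> R) :
    'cV[R]_a -> 'cV[R]_b -> 'cV[R]_a :=
  fun u v => grad (F ^~ v) u.

Definition C2_fst (a b : nat) (F : 'cV[R]_a -> 'cV[R]_b -> R) : Prop :=
  [/\ forall u v, differentiable (F ^~ v) u,
      continuous (fun w : 'cV[R]_a * 'cV[R]_b => grad_fst F w.1 w.2)
    & C1_fst (grad_fst F)].

End Derivatives.

Definition affine_map (R : realType) (n p : nat)
    (F : 'cV[R]_n -> 'cV[R]_p) : Prop :=
  exists (A : 'M[R]_(p, n)) (b : 'cV[R]_p), forall x, F x = A *m x + b.

(* s is only meaningful on U: outside U its values are arbitrary. *)
Definition single_valued_localization (T Z : topologicalType)
    (S : T -> set Z) (t : T) (z : Z) (U : set T) (V : set Z) (s : T -> Z) :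
    Prop :=
  [/\ S t z, nbhs t U, nbhs z V
    & forall th, U th -> S th `&` V = [set s th]].

Section ParametrizedConvexProgram.
Variables (R : realType) (n m p d : nat).

Variable f0 : 'cV[R]_n -> 'cV[R]_d -> R.
Variable f : 'cV[R]_n -> 'cV[R]_d -> 'cV[R]_m.
Variable h : 'cV[R]_n -> 'cV[R]_d -> 'cV[R]_p.

Definition fcomp (i : 'I_m) : 'cV[R]_n -> 'cV[R]_d -> R :=
  fun x th => f x th i 0.

Definition lagrangian (x : 'cV[R]_n) (lam : 'cV[R]_m) (nu : 'cV[R]_p)
    (th : 'cV[R]_d) : R :=
  f0 x th + (lam^T *m f x th) 0 0 + (nu^T *m h x th) 0 0.

Definition grad_lagrangian (x : 'cV[R]_n) (lam : 'cV[R]_m) (nu : 'cV[R]_p)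
    (th : 'cV[R]_d) : 'cV[R]_n :=
  grad (fun y => lagrangian y lam nu th) x.

(* z = (x, lambda, nu) is encoded as col_mx x (col_mx lambda nu). *)
Definition prim (z : 'cV[R]_(n + (m + p))) : 'cV[R]_n := usubmx z.
Definition dual_ineq (z : 'cV[R]_(n + (m + p))) : 'cV[R]_m := usubmx (dsubmx z).
Definition dual_eq (z : 'cV[R]_(n + (m + p))) : 'cV[R]_p := dsubmx (dsubmx z).

Definition kkt (z : 'cV[R]_(n + (m + p))) (th : 'cV[R]_d) :
    'cV[R]_(n + (m + p)) :=
  col_mx (grad_lagrangian (prim z) (dual_ineq z) (dual_eq z) th)
    (col_mx (diag_mx (dual_ineq z)^T *m f (prim z) th) (h (prim z) th)).

Definition Dz_kkt (z : 'cV[R]_(n + (m + p))) (th : 'cV[R]_d) :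
    'M[R]_(n + (m + p)) :=
  Jac (kkt ^~ th) z.

Definition Dth_kkt (z : 'cV[R]_(n + (m + p))) (th : 'cV[R]_d) :
    'M[R]_(n + (m + p), d) :=
  Jac (kkt z) th.

Definition solution_map (th : 'cV[R]_d) : set 'cV[R]_(n + (m + p)) :=
  [set z | [/\ forall i, f (prim z) th i 0 <= 0,
               h (prim z) th = 0,
               forall i, 0 <= dual_ineq z i 0,
               forall i, dual_ineq z i 0 * f (prim z) th i 0 = 0
             & grad_lagrangian (prim z) (dual_ineq z) (dual_eq z) th = 0]].

Definition slater (th : 'cV[R]_d) : Prop :=
  exists x, (forall i, f x th i 0 < 0) /\ h x th = 0.

Definition degenerate_indices (z : 'cV[R]_(n + (m + p))) (th : 'cV[R]_d) :
    set 'I_m :=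
  [set i | dual_ineq z i 0 = 0 /\ f (prim z) th i 0 = 0].

End ParametrizedConvexProgram.

(* Main.v *)
Require Import Defs.
From HB Require Import structures.
From mathcomp Require Import all_boot all_order all_algebra.
From mathcomp Require Import all_classical all_reals all_analysis.
From mathcomp Require Import ring lra.

Set Implicit Arguments.
Unset Strict Implicit.
Unset Printing Implicit Defensive.

Import Order.TTheory GRing.Theory Num.Theory.
Import numFieldNormedType.Exports.

Local Open Scope classical_set_scope.
Local Open Scope ring_scope.

(** Near the reference point the inequalities in the KKT conditions take care
    of themselves, so that the solution mapping is locally the zero set of the
    KKT function, to which the implicit function theorem applies.

    Since no index is degenerate, every [i] has either a positive multiplier or
    a strictly satisfied constraint at the reference point, and by continuity
    this persists in a neighbourhood ([near_strictly_complementary]).  There,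
    complementary slackness [lam_i * f_i = 0] forces [f_i = 0] in the first case
    and [lam_i = 0] in the second, so both sign conditions follow from the
    vanishing of the KKT function ([solution_mapE]).

    The KKT function is continuously differentiable in all variables jointly
    ([kkt_C1]).  Its ingredients are only assumed to have continuous partial
    derivatives, which together give a joint derivative ([is_diff_joint]) by the
    mean value theorem.  One ingredient is not covered directly by the
    assumptions: the term [D_x h(x,th)^T nu] has to be differentiated in [th].
    As [h] is affine in [x], the columns of [D_x h(x,th)] are the differences
    [h(e_j,th) - h(0,th)], and these are as smooth in [th] as [h] is
    ([grad_lagrangianE]).

    The implicit function theorem ([implicit_function]) is proved with the
    simplified Newton map [z - B G(z,t)], where [B] is the inverse of the
    Jacobian at the reference point.  The mean value theorem makes it a
    [1/2]-contraction of a small closed ball, uniformly in [t]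
    ([newton_contraction]), whence existence of a zero [s t] by the Banach
    fixed point theorem.  The same estimate says that [G(.,t)] expands distances
    by a fixed factor ([expansion_le]), which gives uniqueness and a Lipschitz
    bound for [s]; dividing the first order expansion of [G(s t,t) = 0] by the
    Jacobian then gives the derivative of [s] ([is_diff_implicit]). *)

(** * Differentials by epsilon estimates *)

Section FrechetDifferential.
Context {R : realType} {V W : normedModType R}.

Lemma differentiable_le (F : V -> W) (x : V) (e : R) :
  differentiable F x -> 0 < e ->
  \forall y \near x, `|F y - F x - 'd F x (y - x)| <= e * `|y - x|.
Proof.
move=> /diff_locallyP[_ /eqaddoP dF] e0.
have := dF e e0; rewrite (near_shift 0 x) subr0.
by apply: filterS => y; rewrite /= !fctE /= addrK opprD addrA.
Qed.

(** Uniqueness of the differential: an explicit linear candidate that satisfies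
    the first order estimate settles both existence and value. *)
Lemma differentiable_of_le (F : V -> W) (L : {linear V -> W}) (x : V) :
  continuous L ->
  (forall e, 0 < e ->
     \forall y \near x, `|F y - F x - L (y - x)| <= e * `|y - x|) ->
  differentiable F x /\ 'd F x = L :> (V -> W).
Proof.
move=> cL dF.
have expn : F \o shift x = cst (F x) + L +o_ 0 id.
  apply/eqaddoP => e e0.
  rewrite [\forall z \near _, _ <= _](near_shift x) sub0r.
  near=> y; rewrite /= !fctE /= subrK opprD addrA.
  by near: y; exact: dF.
have dFL := diff_unique cL expn.
by split=> //; apply/diff_locallyP; rewrite dFL.
Unshelve. all: by end_near. Qed.

End FrechetDifferential.

(** * Pointwise continuity and domination *)

Section ContinuityAtAPoint.
Context {R : realType} {T : topologicalType}.

Lemma continuous_atP (V : normedModType R) (f : T -> V) (x : T) :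
  {for x, continuous f} <->
  forall e, 0 < e -> \forall y \near x, `|f y - f x| <= e.
Proof.
split=> [/cvgrPdist_le cf e e0|cf].
  by apply: filterS (cf e e0) => y; rewrite distrC.
apply/(@cvgrPdist_le _ _ _ _ (nbhs_filter x)) => e e0.
by apply: filterS (cf e e0) => y; rewrite distrC.
Qed.

Lemma continuous_at_dominated (V W : normedModType R)
    (f : T -> V) (g : T -> W) (x : T) (C : R) :
  0 <= C -> {for x, continuous g} ->
  (\forall y \near x, `|f y - f x| <= C * `|g y - g x|) ->
  {for x, continuous f}.
Proof.
move=> C0 cg fg; apply/continuous_atP => e e0.
have C1 : 0 < C + 1 by rewrite ltr_wpDl.
have := (continuous_atP g x).1 cg _ (divr_gt0 e0 C1).
move: fg; apply: filterS2 => y /le_trans + gy; apply.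
apply: le_trans (ler_wpM2l C0 gy) _.
by rewrite mulrCA -[leRHS]mulr1 ler_wpM2l ?ltW// ltr_pdivrMr// mul1r ltrDl.
Qed.

End ContinuityAtAPoint.

(** * The entrywise maximum norm on matrices *)

Section MatrixNorm.
Context {R : realType}.

Lemma mxnorm_entry_le m n (A : 'M[R]_(m, n)) i j : `|A i j| <= `|A|.
Proof.
rewrite [leRHS]/Num.norm/= mx_normrE.
exact: (le_bigmax _ (fun k : 'I_m * 'I_n => `|A k.1 k.2|) (i, j)).
Qed.

Lemma mxnorm_le m n (A : 'M[R]_(m, n)) (e : R) : 0 <= e ->
  (forall i j, `|A i j| <= e) -> `|A| <= e.
Proof.
move=> e0 Ae; rewrite [leLHS]/Num.norm/= mx_normrE.
by apply: bigmax_le => // -[i j] _; exact: Ae.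
Qed.

(** The maximum norm is not submultiplicative: each entry of the product is a
    sum of [n] terms, which costs the factor [n]. *)
Lemma mxnormM_le m n p (A : 'M[R]_(m, n)) (B : 'M[R]_(n, p)) :
  `|A *m B| <= n%:R * `|A| * `|B|.
Proof.
apply: mxnorm_le => [|i j]; first by rewrite !mulr_ge0.
rewrite mxE (le_trans (ler_norm_sum _ _ _))//.
rewrite -mulrA mulr_natl -[leRHS](_ : \sum_(k < n) `|A| * `|B| = _); last first.
  by rewrite sumr_const card_ord.
by apply: ler_sum => k _; rewrite normrM ler_pM// mxnorm_entry_le.
Qed.

Lemma continuous_mx (T : topologicalType) m n (F : T -> 'M[R]_(m, n)) x :
  (forall i j, {for x, continuous (fun t => F t i j)}) ->
  {for x, continuous F}.
Proof.
move=> cF; apply/cvgrPdist_le => e e0; near=> y.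
apply: mxnorm_le => [|i j]; first exact: ltW.
rewrite !mxE; move: i j; near: y.
apply: filter_forall => i; apply: filter_forall => j.
exact: (cvgrPdist_le _ _).1 (cF i j) _ e0.
Unshelve. all: by end_near. Qed.

Lemma continuous_entry (T : topologicalType) m n (F : T -> 'M[R]_(m, n)) x i j :
  {for x, continuous F} -> {for x, continuous (fun t => F t i j)}.
Proof.
move=> cF.
apply: (@continuous_comp _ _ _ F (fun A : 'M[R]_(m, n) => A i j)) => //.
exact: coord_continuous.
Qed.

Lemma linear_bounded_continuous (V W : normedModType R)
    (L : {linear V -> W}) k :
  (forall v, `|L v| <= k * `|v|) -> continuous L.
Proof.
move=> Lk x; have k1 : 0 < `|k| + 1 by rewrite ltr_wpDl.
apply/cvgrPdist_le => e e0; near=> y.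
rewrite -linearB (le_trans (Lk _))//.
apply: (@le_trans _ _ ((`|k| + 1) * `|x - y|)).
  by rewrite ler_wpM2r// (le_trans (ler_norm k))// lerDl.
rewrite mulrC -ler_pdivlMr//; near: y.
by apply: cvgr_dist_le; [exact: cvg_id|rewrite divr_gt0].
Unshelve. all: by end_near. Qed.

Lemma mulmx_continuous m n p (A : 'M[R]_(m, n)) :
  continuous (mulmx A : 'M[R]_(n, p) -> 'M[R]_(m, p)).
Proof. by apply: linear_bounded_continuous => v; exact: mxnormM_le. Qed.

Lemma mulmxr_continuous m n p (B : 'M[R]_(n, p)) :
  continuous (mulmxr B : 'M[R]_(m, n) -> 'M[R]_(m, p)).
Proof.
apply: linear_bounded_continuous => v.
by rewrite /= (le_trans (mxnormM_le _ _))// mulrAC.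
Qed.

Lemma colE_sum n (v : 'cV[R]_n) : v = \sum_j v j 0 *: delta_mx j 0.
Proof.
by rewrite {1}[v]matrix_sum_delta; apply: eq_bigr => j _; rewrite big_ord1.
Qed.

Lemma linear_colE n (W : lmodType R) (L : {linear 'cV[R]_n -> W}) v :
  L v = \sum_j v j 0 *: L (delta_mx j 0).
Proof.
by rewrite {1}[v]colE_sum linear_sum; apply: eq_bigr => j _; rewrite linearZ.
Qed.

Lemma diff_Jac n k (F : 'cV[R]_n -> 'cV[R]_k) x v :
  'd F x v = Jac F x *m v.
Proof.
rewrite linear_colE; apply/colP => i; rewrite summxE mxE.
by apply: eq_bigr => j _; rewrite !mxE mulrC.
Qed.

Lemma Jac_of_diff n k (F : 'cV[R]_n -> 'cV[R]_k) x (A : 'M[R]_(k, n)) :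
  (forall v, 'd F x v = A *m v) -> Jac F x = A.
Proof.
move=> dF; apply/matrixP => i j; rewrite mxE dF.
by rewrite -colE mxE.
Qed.

End MatrixNorm.

(** * Coordinates of matrix-valued maps *)

Section Coordinates.
Context {R : realType} {V : normedModType R} {m n : nat}.
Implicit Types F : V -> 'M[R]_(m, n).

Lemma is_diff_entry F x i j : differentiable F x ->
  differentiable (fun u => F u i j) x /\
  'd (fun u => F u i j) x = (fun v => 'd F x v i j) :> (V -> R).
Proof.
move=> dF; pose c := fun N : 'M[R]_(m, n) => N i j.
have c_lin : linear c by move=> a u v; rewrite /c !mxE.
pose cM := GRing.isLinear.Build _ _ _ _ _ c_lin.
pose cL : {linear 'M[R]_(m, n) -> R} := HB.pack c cM.
have cc : continuous cL by exact: coord_continuous.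
have dc : differentiable cL (F x) by exact: linear_differentiable.
split; first exact: (differentiable_comp dF dc).
have -> : (fun u => F u i j) = cL \o F by [].
by rewrite (diff_comp dF dc) diff_lin.
Qed.

Lemma differentiable_mx F x :
  (forall i j, differentiable (fun u => F u i j) x) -> differentiable F x.
Proof.
move=> dF; pose L v := \matrix_(i, j) 'd (fun u => F u i j) x v.
have L_lin : linear L.
  by move=> a u v; apply/matrixP => i j; rewrite !mxE linearP.
pose LM := GRing.isLinear.Build _ _ _ _ _ L_lin.
pose LL : {linear V -> 'M[R]_(m, n)} := HB.pack L LM.
have cL : continuous LL.
  move=> v; apply: continuous_mx => i j.
  have -> : (fun v => LL v i j) = 'd (fun u => F u i j) x.
    by apply/funext => w; rewrite /= mxE.
  exact: (diff_continuous (dF i j)).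
apply: (proj1 (differentiable_of_le cL _)) => e e0.
near=> y; apply: mxnorm_le => [|i j].
  by rewrite mulr_ge0 // ltW.
rewrite !mxE; move: i j; near: y.
apply: filter_forall => i; apply: filter_forall => j.
exact: (differentiable_le (dF i j) e0).
Unshelve. all: by end_near. Qed.

End Coordinates.

(** * Mean value estimates *)

Section MeanValue.
Context {R : realType}.

(** The one-dimensional mean value theorem along the segment from [x] to [y]. *)
Lemma mean_value (V : normedModType R) (phi : V -> R) (x y : V) :
  (forall z, differentiable phi z) ->
  exists2 t, 0 <= t <= 1 & phi y - phi x = 'd phi (x + t *: (y - x)) (y - x).
Proof.
move=> dphi; set v := y - x.
pose g (t : R) : V := x + t *: v.
have dg (t : R) : is_diff t g ( *:%R^~ v).
  have -> : g = cst x + ( *:%R^~ v) by [].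
  by apply: is_diff_eq; rewrite add0r.
have dpsi (t : R) : is_derive t 1 (phi \o g : R -> R) ('d phi (g t) v).
  have dgt : differentiable g t by exact: ex_diff.
  have dpg : differentiable (phi \o g) t by exact: differentiable_comp.
  apply: DeriveDef; first exact: diff_derivable.
  by rewrite deriveE// diff_comp//= diff_val scale1r.
have [|t] := @MVT_segment R (phi \o g) (fun t : R => 'd phi (g t) v) 0 1 ler01.
  apply: continuous_subspaceT => t.
  have dgt : differentiable g (t : R) by exact: ex_diff.
  by apply: differentiable_continuous; exact: differentiable_comp.
rewrite in_itv/= subr0 mulr1 /g scale1r scale0r addr0 /v (addrC x) subrK.
by move=> t01 E; exists t.
Qed.

(** There is no mean value equality for vector-valued maps: each coordinate has
    its own intermediate point.  Comparing every coordinate with one fixed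
    matrix [M] makes the estimate uniform. *)
Lemma mean_value_le a b (F : 'cV[R]_a -> 'cV[R]_b) (M : 'M[R]_(b, a)) e x y :
  (forall u, differentiable F u) ->
  (forall t, 0 <= t <= 1 -> `|Jac F (x + t *: (y - x)) - M| <= e) ->
  `|F y - F x - M *m (y - x)| <= a%:R * e * `|y - x|.
Proof.
move=> dF JM.
have e0 : 0 <= e by apply: le_trans (JM 0 _); rewrite ?lexx ?ler01.
apply: mxnorm_le => [|i j]; first by rewrite !mulr_ge0.
rewrite (ord1 j) {j}.
have [//|t t01] := @mean_value _ (fun u => F u i 0) x y.
  by move=> z; have [] := is_diff_entry i 0 (dF z).
have [_ ->] := is_diff_entry i 0 (dF (x + t *: (y - x))).
rewrite diff_Jac => E.
have -> : (F y - F x - M *m (y - x)) i 0 =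
    ((Jac F (x + t *: (y - x)) - M) *m (y - x)) i 0.
  by rewrite mulmxBl [LHS]mxE [RHS]mxE -E !mxE.
rewrite (le_trans (mxnorm_entry_le _ _ _))// (le_trans (mxnormM_le _ _))//.
by rewrite ler_wpM2r// ler_wpM2l// JM.
Qed.

End MeanValue.

(** * From partial to joint differentiability *)

Section PartialToJoint.
Context {R : realType} {a b k : nat}.
Implicit Types F : 'cV[R]_a -> 'cV[R]_b -> 'cV[R]_k.

(** The increment of [F] is split into a horizontal step at the final value of
    [v], controlled by the mean value estimate and the joint continuity of the
    first partial Jacobian, and a vertical step at [w0.1], where plain
    differentiability is enough. *)
Lemma is_diff_joint F w0 :
  (forall u v, differentiable (F ^~ v) u) ->
  {for w0, continuous
     (fun w : 'cV[R]_a * 'cV[R]_b => Jac (F ^~ w.2) w.1)} ->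
  differentiable (F w0.1) w0.2 ->
  differentiable (fun w : 'cV[R]_a * 'cV[R]_b => F w.1 w.2) w0 /\
  'd (fun w : 'cV[R]_a * 'cV[R]_b => F w.1 w.2) w0 =
    (fun e => Jac (F ^~ w0.2) w0.1 *m e.1 + Jac (F w0.1) w0.2 *m e.2)
    :> ('cV[R]_a * 'cV[R]_b -> 'cV[R]_k).
Proof.
case: w0 => u0 v0 /= dF1 cJ dF2.
set A := Jac _ u0; set B := Jac _ v0.
pose L (e : 'cV[R]_a * 'cV[R]_b) := A *m e.1 + B *m e.2.
have L_lin : linear L.
  by move=> c u v; rewrite /L !mulmxDr -!scalemxAr scalerDr addrACA.
pose LM := GRing.isLinear.Build _ _ _ _ _ L_lin.
pose LL : {linear ('cV[R]_a * 'cV[R]_b)%type -> 'cV[R]_k} := HB.pack L LM.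
have n1 (e : 'cV[R]_a * 'cV[R]_b) : `|e.1| <= `|e|.
  by rewrite prod_normE le_max lexx.
have n2 (e : 'cV[R]_a * 'cV[R]_b) : `|e.2| <= `|e|.
  by rewrite prod_normE le_max lexx orbT.
have cL : continuous LL.
  apply: (@linear_bounded_continuous _ _ _ _ (a%:R * `|A| + b%:R * `|B|)) => e.
  rewrite (le_trans (ler_normD _ _))// mulrDl lerD//;
    by rewrite (le_trans (mxnormM_le _ _))// ler_wpM2l// mulr_ge0.
apply: (differentiable_of_le cL) => e e0.
(* The mean value estimate multiplies the oscillation of the Jacobian by [a];
   the added 1 keeps the denominator positive when [a] is 0. *)
pose e1 := e / 2 / (a%:R + 1).
have e10 : 0 < e1 by rewrite !divr_gt0// ltr_wpDl.
move/cvgrPdist_le : cJ => /(_ _ e10) nJ.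
have [r /= r0 Hr] := (@nbhs_ballP R ('cV[R]_a * 'cV[R]_b)%type (u0, v0) _).1 nJ.
have := differentiable_le dF2 (divr_gt0 e0 (ltr0Sn R 1)).
move=> /nbhs_ballP[r'/= r'0 Hr'].
have rr' : 0 < Num.min r r' by rewrite lt_min r0 r'0.
apply/nbhs_ballP; exists (Num.min r r') => //= -[u v] [/= uw vw].
have vr : ball v0 r v by apply: le_ball vw; rewrite ge_min lexx.
have vr' : ball v0 r' v by apply: le_ball vw; rewrite ge_min lexx orbT.
have ur : ball u0 r u by apply: le_ball uw; rewrite ge_min lexx.
have {vr'} /= := Hr' _ vr'; rewrite diff_Jac -/B => Hv.
have Hu : `|F u v - F u0 v - A *m (u - u0)| <= a%:R * e1 * `|u - u0|.
  apply: (@mean_value_le _ _ _ (F ^~ v)) => // t /andP[t0 t1].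
  rewrite distrC; apply: (Hr (u0 + t *: (u - u0), v)); split => //=.
  move: ur; rewrite -!ball_normE/= => ur.
  rewrite opprD addNKr normrN normrZ ger0_norm// distrC.
  by apply: le_lt_trans ur; rewrite ler_piMl.
set w := (u, v) - (u0, v0).
have E : F u v - F u0 v0 - (A *m (u - u0) + B *m (v - v0)) =
   (F u v - F u0 v - A *m (u - u0)) + (F u0 v - F u0 v0 - B *m (v - v0)).
  move: (A *m _) (B *m _) => X Y.
  by apply/matrixP => i j; rewrite !mxE; ring.
rewrite /L/= E (le_trans (ler_normD _ _))//.
apply: (@le_trans _ _ (a%:R * e1 * `|w| + e / 2 * `|w|)).
  apply: lerD.
    by apply: le_trans Hu _; apply: ler_wpM2l (n1 w); rewrite mulr_ge0// ltW.
  by apply: le_trans Hv _; apply: ler_wpM2l (n2 w); rewrite divr_ge0// ltW.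
rewrite -mulrDl ler_wpM2r// [leRHS]splitr lerD2r /e1 mulrA.
rewrite ler_pdivrMr ?ltr_wpDl//.
by rewrite mulrC ler_wpM2l ?lerDl// divr_ge0 ?ltW.
Qed.

End PartialToJoint.

(** * Perturbation of an invertible Jacobian *)

Lemma le_half_self (R : realFieldType) (x y : R) :
  x <= 2^-1 * x + y -> x <= 2 * y.
Proof. lra. Qed.

Section PerturbedInverse.
Context {R : realType} {a : nat} (J0 B : 'M[R]_a) (e : R).
(** The second hypothesis makes [B *m M] differ from the identity by an operator
    of norm at most one half whenever [M] is [e]-close to [J0]; the factors [a]
    come from [mxnormM_le]. *)
Hypothesis (BJ0 : B *m J0 = 1%:M) (Be : a%:R * `|B| * (a%:R * e) <= 2^-1).

(** Writing [X = B J0 X = B (J0 - M) X + B (M X)], the first summand is at most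
    half of [X] and is absorbed in the left-hand side. *)
Lemma perturbed_inverse_le (M : 'M[R]_a) k (X : 'M[R]_(a, k)) :
  `|M - J0| <= e -> `|X| <= 2 * (a%:R * `|B|) * `|M *m X|.
Proof.
move=> MJ0.
have XE : X = B *m ((J0 - M) *m X) + B *m (M *m X).
  by rewrite -mulmxDr -mulmxDl subrK mulmxA BJ0 mul1mx.
have h1 : `|B *m ((J0 - M) *m X)| <= 2^-1 * `|X|.
  apply: le_trans (mxnormM_le _ _) _.
  apply: le_trans (ler_wpM2r (normr_ge0 X) Be).
  rewrite -[leRHS]mulrA ler_wpM2l ?mulr_ge0//.
  apply: le_trans (mxnormM_le _ _) _.
  by rewrite ler_wpM2r// ler_wpM2l// distrC.
have h2 := mxnormM_le B (M *m X).
have h3 : `|X| <= `|B *m ((J0 - M) *m X)| + `|B *m (M *m X)|.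
  by rewrite {1}XE ler_normD.
rewrite -mulrA; apply: le_half_self; apply: le_trans h3 _.
exact: lerD.
Qed.

(** The bound [perturbed_inverse_le] makes the kernel of [M] trivial. *)
Lemma perturbed_unitmx (M : 'M[R]_a) : `|M - J0| <= e -> M \in unitmx.
Proof.
move=> MJ0; rewrite -unitmx_tr -row_free_unit -kermx_eq0.
have MK : M *m (kermx M^T)^T = 0.
  by apply: trmx_inj; rewrite trmx_mul trmxK mulmx_ker trmx0.
have := perturbed_inverse_le (kermx M^T)^T MJ0.
rewrite MK normr0 mulr0 normr_le0.
by rewrite -(inj_eq trmx_inj) trmx0.
Qed.

Variable F : 'cV[R]_a -> 'cV[R]_a.
Hypothesis dF : forall u, differentiable F u.
Variables x y : 'cV[R]_a.
Hypothesis FJ0 : forall t, 0 <= t <= 1 -> `|Jac F (x + t *: (y - x)) - J0| <= e.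

(** The left-hand side is the difference of the values of the simplified Newton
    map [z - B F(z)] at [y] and [x]. *)
Lemma newton_contraction :
  `|(y - x) - B *m (F y - F x)| <= 2^-1 * `|y - x|.
Proof.
have -> : (y - x) - B *m (F y - F x) = - (B *m (F y - F x - J0 *m (y - x))).
  by rewrite [in RHS]mulmxBr [in RHS]mulmxA BJ0 mul1mx opprB.
rewrite normrN; apply: le_trans (mxnormM_le _ _) _.
apply: le_trans (ler_wpM2r (normr_ge0 _) Be).
by rewrite -[leRHS]mulrA ler_wpM2l ?mulr_ge0//; exact: mean_value_le.
Qed.

(** A contraction moves points closer by a factor one half, so the correction
    [B (F y - F x)] has to account for the remaining half of [y - x]. *)
Lemma expansion_le : `|y - x| <= 2 * (a%:R * `|B|) * `|F y - F x|.
Proof.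
rewrite -mulrA; apply: le_half_self.
apply: le_trans (lerD newton_contraction (mxnormM_le _ _)).
by rewrite -{1}[y - x](subrK (B *m (F y - F x))) ler_normD.
Qed.

End PerturbedInverse.

(** * The implicit function theorem *)

Section ImplicitDerivative.
Context {R : realType} {a b : nat}.
Implicit Types (G : 'cV[R]_a -> 'cV[R]_b -> 'cV[R]_a)
  (s : 'cV[R]_b -> 'cV[R]_a).

(** The Lipschitz-type bound on [s] serves twice: it makes [s] continuous, so
    that the expansion of [G] at [(s t1, t1)] may be evaluated at [(s t, t)],
    and it converts the remainder, small relative to [|s t - s t1| + |t - t1|],
    into one small relative to [|t - t1|]. *)
Lemma is_diff_implicit G s t1 (C : R) :
  C1_fst G -> differentiable (G (s t1)) t1 -> 0 <= C ->
  (\forall t \near t1, G (s t) t = 0) ->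
  (\forall t \near t1, `|s t - s t1| <= C * `|G (s t1) t - G (s t1) t1|) ->
  Jac (G ^~ t1) (s t1) \in unitmx ->
  (forall v : 'cV[R]_a, `|v| <= C * `|Jac (G ^~ t1) (s t1) *m v|) ->
  differentiable s t1 /\
  Jac s t1 = - (invmx (Jac (G ^~ t1) (s t1)) *m Jac (G (s t1)) t1).
Proof.
move=> [dG1 cG1] dG2 C0 Gs0 sC uJ JC.
set J := Jac _ (s t1) in uJ JC *; set H := Jac (G (s t1)) t1.
have cs : {for t1, continuous s}.
  exact: continuous_at_dominated C0 (differentiable_continuous dG2) sC.
(* Near [t1] the increment of [G (s t1)] is at most its linear part plus
   [|t - t1|], so [K] is a Lipschitz constant of [s] at [t1]. *)
pose K := C * (b%:R * `|H| + 1).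
have K0 : 0 <= K by rewrite mulr_ge0// addr_ge0// mulr_ge0.
have sK : \forall t \near t1, `|s t - s t1| <= K * `|t - t1|.
  have := differentiable_le dG2 (@ltr01 R).
  move: sC; apply: filterS2 => t sC; rewrite diff_Jac -/H mul1r => HG.
  apply: le_trans sC _; rewrite -mulrA ler_wpM2l//.
  rewrite -[X in `|X|](subrK (H *m (t - t1))) (le_trans (ler_normD _ _))//.
  by rewrite addrC mulrDl mul1r lerD// mxnormM_le.
have [dG JG] := is_diff_joint dG1 (cG1 (s t1, t1))
  (dG2 : differentiable (G (s t1, t1).1) (s t1, t1).2).
have st : {for t1, continuous (fun t => (s t, t))}.
  exact: (cvg_pair cs (@cvg_id _ (nbhs t1))).
have := @differentiable_of_le _ _ _ s (mulmx (- (invmx J *m H))) t1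
  (@mulmx_continuous R a b 1 _).
case=> [e e0|ds dsE]; last first.
  by split=> //; apply: Jac_of_diff => v; rewrite dsE.
(* The remainder is multiplied by [K + 1] when [|s t - s t1|] is bounded by
   [|t - t1|], and by [C] when the Jacobian is inverted. *)
pose e' := e / ((C + 1) * (K + 1)).
have CK0 : 0 < (C + 1) * (K + 1) by rewrite mulr_gt0// ltr_wpDl.
have e'0 : 0 < e' by rewrite divr_gt0.
have nG : \forall t \near t1,
    `|G (s t) t - G (s t1) t1 - (J *m (s t - s t1) + H *m (t - t1))|
      <= e' * `|(s t - s t1, t - t1)|.
  refine (@filterS _ (nbhs t1) _ _ _ _ (st _ (differentiable_le dG e'0))).
  by move=> t; rewrite /= JG.
near=> t.
have : `|G (s t) t - G (s t1) t1 - (J *m (s t - s t1) + H *m (t - t1))|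
    <= e' * `|(s t - s t1, t - t1)|.
  by near: t.
have Gt1 : G (s t1) t1 = 0 by exact: (nbhs_singleton Gs0).
have -> : G (s t) t = 0 by near: t.
rewrite Gt1 subrr sub0r normrN => HG.
have {HG} : `|J *m (s t - s t1) + H *m (t - t1)| <= e' * ((K + 1) * `|t - t1|).
  apply: le_trans HG _; apply: ler_wpM2l; first exact: ltW.
  rewrite prod_normE/= ge_max mulrDl mul1r.
  rewrite lerDr mulr_ge0// andbT.
  have : `|s t - s t1| <= K * `|t - t1| by near: t.
  by move=> /le_trans; apply; rewrite lerDl.
move=> HG.
rewrite /= mulNmx opprK; apply: le_trans (JC _) _.
rewrite mulmxDr mulmxA mulmxA mulmxV// mul1mx.
apply: le_trans (ler_wpM2l C0 HG) _.
rewrite [leRHS](_ : _ = (C + 1) * (e' * ((K + 1) * `|t - t1|))); last first.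
  have {1}-> : e = e' * ((C + 1) * (K + 1)) by rewrite divfK ?gt_eqF.
  by ring.
by rewrite ler_wpM2r ?lerDl// mulr_ge0 ?(ltW e'0)// mulr_ge0// addr_ge0.
Unshelve. all: by end_near. Qed.

End ImplicitDerivative.

Section ImplicitFunction.
Context {R : realType} {a b : nat} (G : 'cV[R]_a -> 'cV[R]_b -> 'cV[R]_a).
Hypotheses (G1 : C1_fst G) (G2 : C1_snd G).

(** The set [P] stands for any further condition that holds near the reference
    point and should be preserved by the choice of [V] and [U]. *)
Theorem implicit_function (z0 : 'cV[R]_a) (t0 : 'cV[R]_b)
    (P : set ('cV[R]_a * 'cV[R]_b)) :
  G z0 t0 = 0 -> Jac (G ^~ t0) z0 \in unitmx -> nbhs (z0, t0) P ->
  exists (s : 'cV[R]_b -> 'cV[R]_a) V U,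
  [/\ open_nbhs t0 U, nbhs z0 V, (forall z t, V z -> U t -> P (z, t)),
      (forall t, U t -> [/\ V (s t), G (s t) t = 0 &
                            forall z, V z -> G z t = 0 -> z = s t])
    & forall t, U t ->
      [/\ differentiable s t, Jac (G ^~ t) (s t) \in unitmx,
          Jac s t = - (invmx (Jac (G ^~ t) (s t)) *m Jac (G (s t)) t)
        & {for t, continuous (Jac s)}]].
Proof.
case: G1 G2 => [dG1 cG1] [dG2 cG2] G0 uJ nP.
pose J0 := Jac (G ^~ t0) z0; pose B := invmx J0.
rewrite -/J0 in uJ.
have BJ0 : B *m J0 = 1%:M by rewrite mulVmx.
(* [e] is the admissible oscillation of the Jacobian: it solves [kap * e <= 1/2]
   also when [kap] is 0. *)
pose kap := a%:R * `|B| * a%:R.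
have kap0 : 0 <= kap by rewrite !mulr_ge0.
pose e : R := 2^-1 / (kap + 1).
have e0 : 0 < e by rewrite divr_gt0// ltr_wpDl.
have Be : a%:R * `|B| * (a%:R * e) <= 2^-1.
  rewrite mulrA -/kap /e mulrA ler_pdivrMr ?ltr_wpDl//.
  by rewrite mulrC ler_wpM2l// lerDl.
pose C := 2 * (a%:R * `|B|).
have C0 : 0 <= C by rewrite !mulr_ge0.
have nJ := (continuous_atP _ _).1 (cG1 (z0, t0)) _ e0.
have [rho /= rho0 Hrho] :=
  (@nbhs_ballP R ('cV[R]_a * 'cV[R]_b)%type (z0, t0) _).1
   (filterI nP nJ).
pose r := rho / 2.
have r0 : 0 < r by rewrite divr_gt0.
have rrho : r < rho by rewrite /r gtr_pMr// invf_lt1// ltr1n.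
pose V := closed_ball z0 r.
have VE z : V z <-> `|z - z0| <= r.
  by rewrite /V closed_ballE// /closed_ball_/= distrC.
have inreg z t : V z -> ball t0 rho t ->
    P (z, t) /\ `|Jac (G ^~ t) z - J0| <= e.
  move=> /VE zV tU; apply: (Hrho (z, t)); split => //=.
  by rewrite -ball_normE/= distrC (le_lt_trans zV).
have Vconv x y t : V x -> V y -> 0 <= t <= 1 -> V (x + t *: (y - x)).
  move=> /VE Vx /VE Vy /andP[t0' t1]; apply/VE.
  have -> : x + t *: (y - x) - z0 = (1 - t) *: (x - z0) + t *: (y - z0).
    by apply/matrixP => i j; rewrite !mxE; ring.
  rewrite (le_trans (ler_normD _ _))// !normrZ !ger0_norm ?subr_ge0//.
  have -> : r = (1 - t) * r + t * r by ring.
  by apply: lerD; rewrite ler_wpM2l// subr_ge0.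
have dseg x y t : V x -> V y -> ball t0 rho t ->
    forall tau, 0 <= tau <= 1 -> `|Jac (G ^~ t) (x + tau *: (y - x)) - J0| <= e.
  move=> Vx Vy tU tau tau01.
  by have [] := inreg _ t (Vconv _ _ _ Vx Vy tau01) tU.
have expand x y t : V x -> V y -> ball t0 rho t ->
    `|y - x| <= C * `|G y t - G x t|.
  move=> Vx Vy tU.
  exact: (expansion_le BJ0 Be (dG1 ^~ t) (dseg _ _ _ Vx Vy tU)).
(* The Newton map contracts by one half, so it preserves the ball of radius [r]
   as soon as it moves the centre by at most [r / 2]. *)
have [delta /= delta0 Hdelta] : nbhs_ball t0
    [set t | `|B *m G z0 t| <= r / 2].
  apply/nbhs_ballP.
  have cB : {for t0, continuous (fun t => B *m G z0 t)}.
    apply: (continuous_at_dominated _ (differentiable_continuous (dG2 z0 t0))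
      (C := a%:R * `|B|)); first by rewrite mulr_ge0.
    by apply: filterE => t; rewrite -mulmxBr mxnormM_le.
  have := (continuous_atP _ _).1 cB (r / 2) (divr_gt0 r0 (ltr0Sn R 1)).
  by apply: filterS => t; rewrite G0 mulmx0 subr0.
pose U := ball t0 (Num.min rho delta).
have UU t : U t -> ball t0 rho t /\ ball t0 delta t.
  by move=> Ut; split; apply: le_ball Ut; rewrite ge_min lexx ?orbT.
have exs t : U t -> exists2 z, V z & G z t = 0.
  move=> /UU[tr td].
  pose phi z := z - B *m G z t.
  have Vz0 : V z0 by apply/VE; rewrite subrr normr0 ltW.
  have phi_contr x y : V x -> V y -> `|phi y - phi x| <= 2^-1 * `|y - x|.
    move=> Vx Vy.
    have -> : phi y - phi x = (y - x) - B *m (G y t - G x t).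
      rewrite mulmxBr /phi; move: (B *m _) (B *m _) => X Y.
      by apply/matrixP => i j; rewrite !mxE; ring.
    exact: (newton_contraction BJ0 Be (dG1 ^~ t) (dseg _ _ _ Vx Vy tr)).
  have phiV : set_fun V V phi.
    move=> z Vz; apply/VE.
    have -> : phi z - z0 = (phi z - phi z0) + (phi z0 - z0) by rewrite subrKA.
    rewrite (le_trans (ler_normD _ _))// [leRHS]splitr lerD//.
      apply: le_trans (phi_contr _ _ Vz0 Vz) _.
      by rewrite mulrC ler_wpM2r//; exact/VE.
    by rewrite /phi addrAC subrr sub0r normrN; exact: Hdelta.
  pose f : {fun V >-> V} := mkfun phiV.
  have cf : is_contraction f.
    exists (NngNum (ltW (divr_gt0 ltr01 (ltr0Sn R 1)))); split => /=.
      by rewrite mul1r invf_lt1// ltr1n.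
    by move=> [x y] [Vx Vy] /=; rewrite mul1r; exact: phi_contr.
  pose X := HB.pack_for (completeNormedModType R) 'cV[R]_a.
  have [||z Vz] := @banach_fixed_point R X V f cf.
  - exact: closed_ball_closed.
  - by exists z0.
  move=> zE; exists z => //.
  have BG : B *m G z t = 0.
    apply/eqP; rewrite -(inj_eq (@addrI _ (z - B *m G z t))).
    by rewrite addr0 subrK {1}zE.
  by rewrite -[LHS]mul1mx -(mulmxV uJ) -mulmxA BG mulmx0.
(* The default value [z0] is returned only for [t] outside [U]. *)
pose s t := xget z0 [set z | V z /\ G z t = 0].
have sP t : U t -> V (s t) /\ G (s t) t = 0.
  move=> /exs[z Vz Gz].
  by apply: (@xgetPex _ z0 [set z | V z /\ G z t = 0]); exists z.
have openU : open U by exact: ball_open.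
have U0 : U t0 by apply: ballxx; rewrite lt_min rho0.
have nearU t : U t -> \forall t' \near t, U t'.
  by move=> Ut; exact: open_nbhs_nbhs.
have ds t : U t -> differentiable s t /\
    Jac s t = - (invmx (Jac (G ^~ t) (s t)) *m Jac (G (s t)) t).
  move=> Ut; have [Vs Gs] := sP t Ut; have [tr _] := UU _ Ut.
  have [_ sJ] := inreg _ _ Vs tr.
  have Gs0 : \forall t' \near t, G (s t') t' = 0.
    by apply: filterS (nearU t Ut) => t' /sP[].
  have sC : \forall t' \near t, `|s t' - s t| <= C * `|G (s t) t' - G (s t) t|.
    apply: filterS (nearU t Ut) => t' Ut'; have [Vs' Gs'] := sP t' Ut'.
    have [tr' _] := UU _ Ut'.
    by rewrite Gs -Gs' [X in _ <= C * X]distrC; exact: expand.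
  have JC (v : 'cV[R]_a) : `|v| <= C * `|Jac (G ^~ t) (s t) *m v|.
    exact: (perturbed_inverse_le BJ0 Be _ sJ).
  exact: (is_diff_implicit (conj dG1 cG1) (dG2 _ _) C0 Gs0 sC
    (perturbed_unitmx BJ0 Be sJ) JC).
exists s, V, U; split.
- by split.
- by apply/nbhs_closedballP; exists (PosNum r0).
- by move=> z t Vz /UU[tr _]; have [] := inreg _ _ Vz tr.
- move=> t Ut; have [Vs Gs] := sP t Ut; split=> // z Vz Gz; apply/subr0_eq/eqP.
  rewrite -normr_le0; have [tr _] := UU _ Ut.
  by have := expand (s t) z t Vs Vz tr; rewrite Gz Gs subrr normr0 mulr0.
move=> t Ut; have [dst JE] := ds t Ut; have [Vs Gs] := sP t Ut.
have [tr _] := UU _ Ut; have [_ sJ] := inreg _ _ Vs tr.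
split; [exact: dst|exact: (perturbed_unitmx BJ0 Be sJ)|exact: JE|].
(* The Jacobian of [s] solves a linear system whose matrix and right-hand side
   are continuous in [t'].  Its continuity at [t] follows without the continuity
   of matrix inversion: [N t'] is the residual of the fixed candidate [X] in the
   system at [t'], it is continuous and vanishes at [t], and as the matrix
   expands norms by a uniform factor, the residual bounds the distance from [X]
   to the solution. *)
have [X XE] : exists X, Jac s t = X by exists (Jac s t).
pose N t' := Jac (G (s t')) t' + Jac (G ^~ t') (s t') *m X.
have JX t' : U t' -> Jac (G ^~ t') (s t') *m Jac s t' = - Jac (G (s t')) t'.
  move=> Ut'; have [_ ->] := ds t' Ut'; have [Vs' _] := sP t' Ut'.
  have [tr' _] := UU _ Ut'; have [_ sJ'] := inreg _ _ Vs' tr'.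
  by rewrite mulmxN mulmxA (mulmxV (perturbed_unitmx BJ0 Be sJ')) mul1mx.
have cst : {for t, continuous (fun t' => (s t', t'))}.
  exact: (cvg_pair (differentiable_continuous dst) (@cvg_id _ (nbhs t))).
have cH : {for t, continuous (fun t' => Jac (G (s t')) t')}.
  exact: (@continuous_comp _ _ _ (fun t' => (s t', t'))
    (fun w : 'cV[R]_a * 'cV[R]_b => Jac (G w.1) w.2) t cst (cG2 (s t, t))).
have cJ : {for t, continuous (fun t' => Jac (G ^~ t') (s t'))}.
  exact: (@continuous_comp _ _ _ (fun t' => (s t', t'))
    (fun w : 'cV[R]_a * 'cV[R]_b => Jac (G ^~ w.2) w.1) t cst (cG1 (s t, t))).
have cJX : {for t, continuous (fun t' => Jac (G ^~ t') (s t') *m X)}.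
  exact: (@continuous_comp _ _ _ (fun t' => Jac (G ^~ t') (s t'))
    (mulmxr X) t cJ (@mulmxr_continuous _ _ _ _ _ _)).
have cN : {for t, continuous N} by exact: (cvgD cH cJX).
apply: (continuous_at_dominated C0 cN).
apply: filterS (nearU t Ut) => t' Ut'.
have [Vs' _] := sP t' Ut'; have [tr' _] := UU _ Ut'.
have [_ sJ'] := inreg _ _ Vs' tr'.
apply: le_trans (perturbed_inverse_le BJ0 Be _ sJ') _.
apply: ler_wpM2l => //.
have Nt0 : N t = 0.
  by have := JX t Ut; rewrite XE /N => ->; rewrite subrr.
have JX' := JX t' Ut'.
by rewrite XE Nt0 subr0 mulmxBr JX' -normrN opprD !opprK.
Qed.

End ImplicitFunction.

(** * Calculus of continuously differentiable maps *)

(** The continuity of the differential is required direction by direction.  On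
    the finite-dimensional spaces used below this is the usual notion, and it
    avoids a norm on linear maps. *)
Definition C1 {R : realType} {V W : normedModType R} (F : V -> W) : Prop :=
  (forall x, differentiable F x) /\ forall e, continuous (fun x => 'd F x e).

Section C1Calculus.
Context {R : realType}.

Lemma C1_continuous (V W : normedModType R) (F : V -> W) : C1 F -> continuous F.
Proof. by case=> dF _ x; exact: differentiable_continuous. Qed.

Lemma C1_lin (V W : normedModType R) (L : {linear V -> W}) :
  continuous L -> C1 L.
Proof.
move=> cL; split=> [x|e]; first exact: linear_differentiable.
by under eq_fun do rewrite diff_lin//; exact: cst_continuous.
Qed.

Lemma C1_comp_lin (U V W : normedModType R) (F : V -> W) (L : {linear U -> V}) :
  continuous L -> C1 F -> C1 (F \o L).
Proof.
move=> cL [dF cF]; have dL x := linear_differentiable x cL.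
split=> [x|e]; first exact: differentiable_comp.
have -> : (fun x => 'd (F \o L) x e) = (fun y => 'd F y (L e)) \o L.
  by apply/funext => x; rewrite diff_comp//= diff_lin.
by move=> x; apply: continuous_comp; [exact: cL|exact: cF].
Qed.

Lemma C1_cst (V W : normedModType R) (w : W) : C1 (fun _ : V => w).
Proof.
split=> [x|e]; first exact: differentiable_cst.
have -> : (fun x : V => 'd (fun=> w) x e) = cst 0.
  by apply/funext => x; rewrite diff_cst.
exact: cst_continuous.
Qed.

Lemma C1D (V W : normedModType R) (F G : V -> W) :
  C1 F -> C1 G -> C1 (fun x => F x + G x).
Proof.
move=> [dF cF] [dG cG]; split=> [x|e]; first exact: differentiableD.
have -> : (fun x => 'd (fun x => F x + G x) x e)
    = (fun x => 'd F x e + 'd G x e).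
  by apply/funext => x; rewrite diffD.
by move=> x; apply: cvgD; [exact: cF|exact: cG].
Qed.

Lemma C1B (V W : normedModType R) (F G : V -> W) :
  C1 F -> C1 G -> C1 (fun x => F x - G x).
Proof.
move=> [dF cF] [dG cG]; split=> [x|e]; first exact: differentiableB.
have -> : (fun x => 'd (fun x => F x - G x) x e)
    = (fun x => 'd F x e - 'd G x e).
  by apply/funext => x; rewrite diffB.
by move=> x; apply: cvgB; [exact: cF|exact: cG].
Qed.

Lemma C1M (V : normedModType R) (F G : V -> R) :
  C1 F -> C1 G -> C1 (fun x => F x * G x).
Proof.
move=> C1F C1G; have cF := C1_continuous C1F; have cG := C1_continuous C1G.
case: C1F C1G => dF cdF [dG cdG]; split=> [x|e]; first exact: differentiableM.
have -> : (fun x => 'd (fun x => F x * G x) x e)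
    = (fun x => F x * 'd G x e + G x * 'd F x e).
  by apply/funext => x; rewrite diffM.
move=> x; apply: cvgD; apply: cvgM;
  [exact: cF|exact: cdG|exact: cG|exact: cdF].
Qed.

Lemma C1_sum (V W : normedModType R) (I : Type) (r : seq I) (F : I -> V -> W) :
  (forall i, C1 (F i)) -> C1 (fun x => \sum_(i <- r) F i x).
Proof.
move=> CF; elim: r => [|i r IHr].
  by under eq_fun do rewrite big_nil; exact: C1_cst.
under eq_fun do rewrite big_cons.
by apply: C1D; [exact: CF|exact: IHr].
Qed.

Lemma C1_entry (V : normedModType R) m n (F : V -> 'M[R]_(m, n)) i j :
  C1 F -> C1 (fun x => F x i j).
Proof.
move=> [dF cF]; split=> [x|e]; first by have [] := is_diff_entry i j (dF x).
have -> : (fun x => 'd (fun u => F u i j) x e) = (fun x => 'd F x e i j).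
  by apply/funext => x; have [_ ->] := is_diff_entry i j (dF x).
move=> x.
exact: (@continuous_entry R V m n (fun t => 'd F t e) x i j (cF e x)).
Qed.

Lemma C1_mx (V : normedModType R) m n (F : V -> 'M[R]_(m, n)) :
  (forall i j, C1 (fun x => F x i j)) -> C1 F.
Proof.
move=> CF; have dF x : differentiable F x.
  by apply: differentiable_mx => i j; have [] := CF i j.
split=> [//|e x]; apply: continuous_mx => i j.
have -> : (fun x => 'd F x e i j) = (fun x => 'd (fun u => F u i j) x e).
  by apply/funext => y; have [_ ->] := is_diff_entry i j (dF y).
by have [_] := CF i j; exact.
Qed.

(** The classical criterion: continuous partial derivatives give joint
    continuous differentiability. *)
Lemma C1_joint a b k (F : 'cV[R]_a -> 'cV[R]_b -> 'cV[R]_k) :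
  C1_fst F -> C1_snd F -> C1 (fun w => F w.1 w.2).
Proof.
move=> [dF1 cF1] [dF2 cF2].
have dF w := is_diff_joint dF1 (cF1 w) (dF2 w.1 w.2).
split=> [w|e]; first by have [] := dF w.
have -> : (fun w => 'd (fun w => F w.1 w.2) w e) =
    (fun w => mulmxr e.1 (Jac (F ^~ w.2) w.1) + mulmxr e.2 (Jac (F w.1) w.2)).
  by apply/funext => w; have [_ ->] := dF w.
move=> w; apply: cvgD.
  exact: (@continuous_comp _ _ _
    (fun w : 'cV[R]_a * 'cV[R]_b => Jac (F ^~ w.2) w.1) (mulmxr e.1) w
    (cF1 w) (@mulmxr_continuous _ _ _ _ _ _)).
exact: (@continuous_comp _ _ _
  (fun w : 'cV[R]_a * 'cV[R]_b => Jac (F w.1) w.2) (mulmxr e.2) w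
  (cF2 w) (@mulmxr_continuous _ _ _ _ _ _)).
Qed.

(** Freezing [v] is a composition with the affine map [u |-> (u, v)], whose
    differential is [e |-> (e, 0)]. *)
Lemma C1_joint_fst a b k (F : 'cV[R]_a -> 'cV[R]_b -> 'cV[R]_k) :
  C1 (fun w : 'cV[R]_a * 'cV[R]_b => F w.1 w.2) -> C1_fst F.
Proof.
set FF := fun w => _; move=> [dF cF].
have dp u (v : 'cV[R]_b) :
    is_diff u (fun u : 'cV[R]_a => (u, v)) (fun e => (e, 0)).
  exact: (is_diff_pair (is_diff_id u) (is_diff_cst v u)).
have FE v : F ^~ v = FF \o (fun u => (u, v)) by [].
have dFv u v : differentiable (F ^~ v) u.
  by rewrite FE; apply: differentiable_comp; [exact: ex_diff|exact: dF].
split=> // w; apply: continuous_mx => i j.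
have -> : (fun w : 'cV[R]_a * 'cV[R]_b => Jac (F ^~ w.2) w.1 i j) =
    (fun w => 'd FF w (delta_mx j 0, 0) i 0).
  apply/funext => -[u v]; rewrite mxE FE diff_comp; [|exact: ex_diff|exact: dF].
  by rewrite /= (@diff_val _ _ _ _ _ _ _ (dp u v)).
exact: (@continuous_entry R _ k 1 (fun w => 'd FF w _) w i 0 (cF _ w)).
Qed.

Lemma C1_joint_snd a b k (F : 'cV[R]_a -> 'cV[R]_b -> 'cV[R]_k) :
  C1 (fun w : 'cV[R]_a * 'cV[R]_b => F w.1 w.2) -> C1_snd F.
Proof.
set FF := fun w => _; move=> [dF cF].
have dp (u : 'cV[R]_a) v :
    is_diff v (fun v : 'cV[R]_b => (u, v)) (fun e => (0, e)).
  exact: (is_diff_pair (is_diff_cst u v) (is_diff_id v)).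
have FE u : F u = FF \o (fun v => (u, v)) by [].
have dFu u v : differentiable (F u) v.
  by rewrite FE; apply: differentiable_comp; [exact: ex_diff|exact: dF].
split=> // w; apply: continuous_mx => i j.
have -> : (fun w : 'cV[R]_a * 'cV[R]_b => Jac (F w.1) w.2 i j) =
    (fun w => 'd FF w (0, delta_mx j 0) i 0).
  apply/funext => -[u v]; rewrite mxE FE diff_comp; [|exact: ex_diff|exact: dF].
  by rewrite /= (@diff_val _ _ _ _ _ _ _ (dp u v)).
exact: (@continuous_entry R _ k 1 (fun w => 'd FF w _) w i 0 (cF _ w)).
Qed.

Lemma C1_fst_proj (V W : normedModType R) : C1 (fst : V * W -> V).
Proof.
have fst_lin : linear (fst : V * W -> V) by [].
pose M := GRing.isLinear.Build _ _ _ _ _ fst_lin.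
pose L : {linear (V * W)%type -> V} := HB.pack (fst : V * W -> V) M.
by apply: (@C1_lin _ _ L) => x; exact: cvg_fst.
Qed.

Lemma C1_comp_snd (V W U : normedModType R) (F : W -> U) :
  C1 F -> C1 (fun w : V * W => F w.2).
Proof.
have snd_lin : linear (snd : V * W -> W) by [].
pose M := GRing.isLinear.Build _ _ _ _ _ snd_lin.
pose L : {linear (V * W)%type -> W} := HB.pack (snd : V * W -> W) M.
by apply: (@C1_comp_lin _ _ _ F L) => x; exact: cvg_snd.
Qed.

Lemma C1_section a b k (F : 'cV[R]_a -> 'cV[R]_b -> 'cV[R]_k) u :
  C1_snd F -> C1 (F u).
Proof.
move=> [dF cF]; split=> [v|e]; first exact: dF.
have -> : (fun v => 'd (F u) v e) = (fun v => mulmxr e (Jac (F u) v)).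
  by apply/funext => v; rewrite diff_Jac.
move=> v.
have cp : {for v, continuous (fun v : 'cV[R]_b => (u, v))}.
  exact: (cvg_pair (@cvg_cst _ u _ (nbhs v) _) (@cvg_id _ (nbhs v))).
have cJ : {for v, continuous (Jac (F u))}.
  exact: (@continuous_comp _ _ _ (fun v => (u, v))
    (fun w : 'cV[R]_a * 'cV[R]_b => Jac (F w.1) w.2) v cp (cF (u, v))).
exact: (@continuous_comp _ _ _ (Jac (F u)) (mulmxr e) v cJ
  (@mulmxr_continuous _ _ _ _ _ _)).
Qed.

End C1Calculus.

(** * Smoothness of the KKT function *)

Lemma is_diff_lincomb (R : realType) (V : normedModType R) (I : Type)
    (r : seq I) (c : I -> R) (F : I -> V -> R) (x : V) :
  (forall i, differentiable (F i) x) ->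
  is_diff x (fun y => \sum_(i <- r) c i * F i y)
            (fun v => \sum_(i <- r) c i * 'd (F i) x v).
Proof.
move=> dF; elim: r => [|i r IHr].
  under eq_fun do rewrite big_nil.
  under [X in is_diff _ _ X]eq_fun do rewrite big_nil.
  exact: is_diff_cst.
under eq_fun do rewrite big_cons.
under [X in is_diff _ _ X]eq_fun do rewrite big_cons.
apply: is_diffD.
exact: (is_diffZ (c i) (differentiableP (dF i))).
Qed.

Section AffineConstraint.
Context {R : realType} {n p d : nat} (h : 'cV[R]_n -> 'cV[R]_d -> 'cV[R]_p).
Hypothesis h_affine : forall th, affine_map (h ^~ th).

(** The linear part of an affine map is visible from its values alone, so no
    choice of the matrix depending on [th] enters. *)
Lemma diff_affine th x e :
  differentiable (h ^~ th) x /\ 'd (h ^~ th) x e = h e th - h 0 th.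
Proof.
have [A [b hE]] := h_affine th.
have [|dh dhE] := @differentiable_of_le _ _ _ (h ^~ th) (mulmx A) x
    (@mulmx_continuous _ _ _ _ A).
  move=> eps eps0; apply: filterE => y.
  rewrite /= !hE mulmxBr.
  have -> : A *m y + b - (A *m x + b) - (A *m y - A *m x) = 0.
    by move: (A *m y) (A *m x) => Y X; apply/colP => i; rewrite !mxE; ring.
  by rewrite normr0 mulr_ge0 // ltW.
by split=> //; rewrite dhE !hE mulmx0 add0r addrK.
Qed.

End AffineConstraint.

Section KKT.
Context {R : realType} {n m p d : nat}.
Variable f0 : 'cV[R]_n -> 'cV[R]_d -> R.
Variable f : 'cV[R]_n -> 'cV[R]_d -> 'cV[R]_m.
Variable h : 'cV[R]_n -> 'cV[R]_d -> 'cV[R]_p.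
Hypothesis h_affine : forall th, affine_map (h ^~ th).
Hypotheses (f0_C2x : C2_fst f0) (f_C2x : forall i, C2_fst (fcomp f i)).

(** The contribution of [h] is expressed by values of [h] instead of its
    derivative in [x]: in this form it can be differentiated in [th]. *)
Lemma grad_lagrangianE x lam nu th j :
  grad_lagrangian f0 f h x lam nu th j 0 =
    grad_fst f0 x th j 0
    + \sum_i lam i 0 * grad_fst (fcomp f i) x th j 0
    + \sum_k nu k 0 * (h (delta_mx j 0) th k 0 - h 0 th k 0).
Proof.
have df0 : differentiable (f0 ^~ th) x by case: f0_C2x.
have df i : differentiable (fcomp f i ^~ th) x by case: (f_C2x i).
have dh k : differentiable (fun y => h y th k 0) x.
  have [dh _] := diff_affine h_affine th x 0.
  by have [] := is_diff_entry k 0 dh.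
have LE : (fun y => lagrangian f0 f h y lam nu th) =
    f0 ^~ th + (fun y => \sum_i lam i 0 * fcomp f i y th)
    + (fun y => \sum_k nu k 0 * h y th k 0).
  apply/funext => y; rewrite /lagrangian !fctE !mxE; congr (_ + _ + _);
    by apply: eq_bigr => i _; rewrite mxE.
have Df := is_diff_lincomb (index_enum 'I_m) (fun i => lam i 0) df.
have Dh := is_diff_lincomb (index_enum 'I_p) (fun k => nu k 0) dh.
rewrite mxE LE (@diff_val _ _ _ _ _ _ _
  (is_diffD (is_diffD (differentiableP df0) Df) Dh)) !fctE.
congr (_ + _ + _); first by rewrite mxE.
  by apply: eq_bigr => i _; rewrite mxE.
apply: eq_bigr => k _; congr (_ * _).
have [dhx hE] := diff_affine h_affine th x (delta_mx j 0).
by have [_ ->] := is_diff_entry k 0 dhx; rewrite hE !mxE.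
Qed.

Hypotheses (f_C1th : C1_snd f) (h_C1x : C1_fst h) (h_C1th : C1_snd h).
Hypotheses (Df0_C1th : C1_snd (grad_fst f0))
           (Df_C1th : forall i, C1_snd (grad_fst (fcomp f i))).

Lemma C1_fst_of_fcomp : C1_fst f.
Proof.
have df u v : differentiable (f ^~ v) u.
  apply: differentiable_mx => i j; rewrite (ord1 j).
  by have [+ _ _] := f_C2x i; exact.
split=> // w; apply: continuous_mx => i j.
have -> : (fun w : 'cV[R]_n * 'cV[R]_d => Jac (f ^~ w.2) w.1 i j) =
    (fun w => grad_fst (fcomp f i) w.1 w.2 j 0).
  apply/funext => -[u v]; rewrite !mxE.
  by have [_ ->] := is_diff_entry i 0 (df u v).
have [_ cg _] := f_C2x i.
exact: (@continuous_entry R _ n 1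
  (fun w : 'cV[R]_n * 'cV[R]_d => grad_fst (fcomp f i) w.1 w.2) w j 0 (cg w)).
Qed.

Local Notation Z := 'cV[R]_(n + (m + p)).

Lemma C1_prim k (F : 'cV[R]_n -> 'cV[R]_d -> 'cV[R]_k) :
  C1_fst F -> C1_snd F -> C1 (fun w : Z * 'cV[R]_d => F (prim w.1) w.2).
Proof.
move=> F1 F2; pose q (w : Z * 'cV[R]_d) := (prim w.1, w.2).
have q_lin : linear q by move=> c u v; rewrite /q /prim /= linearP.
pose M := GRing.isLinear.Build _ _ _ _ _ q_lin.
pose L : {linear (Z * 'cV[R]_d)%type -> ('cV[R]_n * 'cV[R]_d)%type} :=
  HB.pack q M.
apply: (@C1_comp_lin _ _ _ _ (fun w => F w.1 w.2) L); last exact: C1_joint.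
apply: (@linear_bounded_continuous _ _ _ L 1) => w.
rewrite mul1r !prod_normE /= ge_max !le_max lexx orbT andbT.
apply/orP; left; apply: mxnorm_le => // i j.
by rewrite mxE; exact: mxnorm_entry_le.
Qed.

Lemma C1_coord i : C1 (fun w : Z * 'cV[R]_d => w.1 i 0).
Proof. by apply: C1_entry; exact: C1_fst_proj. Qed.

Lemma C1_dual_ineq i : C1 (fun w : Z * 'cV[R]_d => dual_ineq w.1 i 0).
Proof. by under eq_fun do rewrite !mxE; exact: C1_coord. Qed.

Lemma kkt_C1 : C1 (fun w : Z * 'cV[R]_d => kkt f0 f h w.1 w.2).
Proof.
have fC1 := C1_prim C1_fst_of_fcomp f_C1th.
have hC1 := C1_prim h_C1x h_C1th.
have g0C1 : C1 (fun w : Z * 'cV[R]_d => grad_fst f0 (prim w.1) w.2).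
  by case: f0_C2x => _ _ g0; exact: (C1_prim g0 Df0_C1th).
have giC1 i : C1 (fun w : Z * 'cV[R]_d => grad_fst (fcomp f i) (prim w.1) w.2).
  by case: (f_C2x i) => _ _ gi; exact: (C1_prim gi (Df_C1th i)).
have nuC1 i : C1 (fun w : Z * 'cV[R]_d => dual_eq w.1 i 0).
  by under eq_fun do rewrite !mxE; exact: C1_coord.
have hsC1 x k : C1 (fun w : Z * 'cV[R]_d => h x w.2 k 0).
  by apply: (@C1_comp_snd _ _ _ _ (fun th => h x th k 0)); apply: C1_entry;
    exact: C1_section.
apply: C1_mx => i j; rewrite {j}(ord1 j).
have [i' ->|i' ->] := split_ordP i.
  under eq_fun do rewrite /kkt col_mxEu grad_lagrangianE.
  have term_f k := C1M (C1_dual_ineq k) (C1_entry i' 0 (giC1 k)).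
  have term_h k := C1M (nuC1 k) (C1B (hsC1 (delta_mx i' 0) k) (hsC1 0 k)).
  exact: (C1D (C1D (C1_entry i' 0 g0C1) (C1_sum _ term_f)) (C1_sum _ term_h)).
have [k ->|k ->] := split_ordP i'.
  under eq_fun do rewrite /kkt col_mxEd col_mxEu mul_diag_mx !mxE.
  exact: (C1M (C1_coord _) (C1_entry k 0 fC1)).
under eq_fun do rewrite /kkt !col_mxEd.
exact: (C1_entry k 0 hC1).
Qed.

(** * The solution mapping near a strictly complementary point *)

Lemma kkt_eq0 z th : kkt f0 f h z th = 0 <->
  [/\ grad_lagrangian f0 f h (prim z) (dual_ineq z) (dual_eq z) th = 0,
      forall i, dual_ineq z i 0 * f (prim z) th i 0 = 0
    & h (prim z) th = 0].
Proof.
have diagE i : (diag_mx (dual_ineq z)^T *m f (prim z) th) i 0 =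
    dual_ineq z i 0 * f (prim z) th i 0 by rewrite mul_diag_mx !mxE.
split=> [/eqP|[g0 fl0 h0]].
  rewrite /kkt !col_mx_eq0 => /and3P[/eqP g0 /eqP fl0 /eqP h0].
  by split=> // i; rewrite -diagE fl0 mxE.
rewrite /kkt g0 h0; have -> : diag_mx (dual_ineq z)^T *m f (prim z) th = 0.
  by apply/colP => i; rewrite diagE fl0 mxE.
by rewrite !col_mx0.
Qed.

Definition strictly_complementary (w : Z * 'cV[R]_d) : Prop :=
  forall i, 0 < dual_ineq w.1 i 0 \/ f (prim w.1) w.2 i 0 < 0.

(** Complementary slackness turns the strict inequality of each index into the
    missing sign of the other factor, which is then zero. *)
Lemma solution_mapE z th : strictly_complementary (z, th) ->
  solution_map f0 f h th z <-> kkt f0 f h z th = 0.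
Proof.
move=> sc; split=> [[_ h0 _ fl0 g0]|/kkt_eq0[g0 fl0 h0]]; first exact/kkt_eq0.
split=> // i; have := fl0 i; have [/= l0|/= f_lt0] := sc i.
- by move=> /eqP; rewrite mulf_eq0 gt_eqF//= => /eqP ->.
- by move=> _; exact: ltW.
- by move=> _; exact: ltW.
- by move=> /eqP; rewrite mulf_eq0 (lt_eqF f_lt0) orbF => /eqP ->.
Qed.

(** Each alternative is a strict inequality on a continuous function, hence
    stable, and there are finitely many indices. *)
Lemma near_strictly_complementary w :
  strictly_complementary w -> nbhs w strictly_complementary.
Proof.
move=> sc.
suff near_i i : \forall w' \near w,
    0 < dual_ineq w'.1 i 0 \/ f (prim w'.1) w'.2 i 0 < 0.
  by apply: filterS (filter_forall (nbhs_filter w) near_i) => w'.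
have cf : {for w, continuous (fun w : Z * 'cV[R]_d => f (prim w.1) w.2 i 0)}.
  exact: (C1_continuous (C1_entry i 0 (C1_prim C1_fst_of_fcomp f_C1th))).
have cl : {for w, continuous (fun w : Z * 'cV[R]_d => dual_ineq w.1 i 0)}.
  exact: (C1_continuous (C1_dual_ineq i)).
have [l0|f_lt0] := sc i.
  by apply: filterS (cvgr_gt _ cl _ l0) => w' ?; left.
by apply: filterS (cvgr_lt _ cf _ f_lt0) => w' ?; right.
Qed.

End KKT.

Theorem theorem3p1 (R : realType) (n m p d : nat)
  (f0 : 'cV[R]_n -> 'cV[R]_d -> R)
  (f : 'cV[R]_n -> 'cV[R]_d -> 'cV[R]_m)
  (h : 'cV[R]_n -> 'cV[R]_d -> 'cV[R]_p)
  (f0_convex : forall th, convex_function [set: 'cV[R]_n] (f0 ^~ th))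
  (f_convex : forall i th, convex_function [set: 'cV[R]_n] (fcomp f i ^~ th))
  (h_affine : forall th, affine_map (h ^~ th))
  (thbar : 'cV[R]_d) (zt : 'cV[R]_(n + (m + p)))
  (kkt_zt : kkt f0 f h zt thbar = 0)
  (f_zt : forall i, f (prim zt) thbar i 0 <= 0)
  (lam_zt : forall i, 0 <= dual_ineq zt i 0)
  (strong_duality : slater f h thbar)
  (f0_C2x : C2_fst f0)
  (f_C2x : forall i, C2_fst (fcomp f i))
  (f_C1th : C1_snd f)
  (h_C1x : C1_fst h)
  (h_C1th : C1_snd h)
  (Df0_C1th : C1_snd (grad_fst f0))
  (Df_C1th : forall i, C1_snd (grad_fst (fcomp f i)))
  (G_empty : degenerate_indices f zt thbar = set0)
  (Dz_nonsingular : Dz_kkt f0 f h zt thbar \in unitmx) :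
  exists (s : 'cV[R]_d -> 'cV[R]_(n + (m + p)))
         (U : set 'cV[R]_d) (V : set 'cV[R]_(n + (m + p))) (Q : set 'cV[R]_d),
    [/\ single_valued_localization (solution_map f0 f h) thbar zt U V s,
        open_nbhs thbar Q /\ Q `<=` U,
        (forall th, Q th -> differentiable s th),
        {within Q, continuous (Jac s)}
      & forall th, Q th ->
          Dz_kkt f0 f h (s th) th \in unitmx /\
          Jac s th =
            - (invmx (Dz_kkt f0 f h (s th) th) *m Dth_kkt f0 f h (s th) th)].
Proof.
have sc : strictly_complementary f (zt, thbar).
  move=> i /=; have := lam_zt i; rewrite le_eqVlt => /predU1P[l0|]; last by left.
  have := f_zt i; rewrite le_eqVlt => /predU1P[fi0|]; last by right.
  suff : degenerate_indices f zt thbar i by rewrite G_empty.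
  by split.
have kC1 := kkt_C1 h_affine f0_C2x f_C2x f_C1th h_C1x h_C1th Df0_C1th Df_C1th.
have near_sc := near_strictly_complementary f_C2x f_C1th sc.
have [s [V [U [nU nV VUsc sU dU]]]] := implicit_function (C1_joint_fst kC1)
  (C1_joint_snd kC1) kkt_zt Dz_nonsingular near_sc.
have U_nbhs := open_nbhs_nbhs nU.
exists s, U, V, U; split.
- split; [|exact: U_nbhs|exact: nV|].
    by apply/(solution_mapE f0 h sc).
  move=> th Uth; have [Vs ks s_uniq] := sU th Uth.
  apply/seteqP; split=> [z [Sz Vz]|z ->].
    by apply: s_uniq => //; apply/(solution_mapE f0 h (VUsc z th Vz Uth)).
  by split=> //; apply/(solution_mapE f0 h (VUsc _ _ Vs Uth)).
- by split.
- by move=> th /dU[].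
- rewrite continuous_open_subspace; last by case: nU.
  by move=> th; rewrite inE => /dU[].
- by move=> th /dU[_ uJ JE _]; split.
Qed.
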